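(* Let $C$ be the middle third Cantor set and let $B$ be an arbitrary nonempty compact metric space. Let $b_n=N(B,3^{-n})$. (1) If $\sum_{n=1}^\infty b_n/2^n$ converges, then $C$ can be mapped onto $B$ by a Lipschitz map. (2) If $C$ can be mapped onto $B$ by a Lipschitz map, then the sequence $b_n/2^n$ must be bounded.
   Context: For a metric space $X$ and $r>0$, $N(X,r)$ is the minimal number of closed balls $\overline{B}(x,r)=\{y\in X:d(x,y)\le r\}$ ($x\in X$) that cover $X$. A map $f$ between metric spaces is Lipschitz if there is a finite constant $L$ with $d(f(x),f(z))\le L\,d(x,z)$ for all $x,z$ in its domain. *)

(* Defs.v *)
From HB Require Import structures.
From mathcomp Require Import all_boot all_order all_algebra.
From mathcomp Require Import all_classical all_reals all_analysis.

Set Implicit Arguments.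
Unset Strict Implicit.
Unset Printing Implicit Defensive.

Import Order.TTheory GRing.Theory Num.Theory.
Import numFieldNormedType.Exports.

Local Open Scope classical_set_scope.
Local Open Scope ring_scope.

(* [closed_ball] of MathComp-Analysis is the closure of the open ball, which
   in a general metric space can be smaller than this set. *)
Definition mclosed_ball (R : realType) (X : metricType R) (x : X) (r : R)
  : set X := [set y | mdist x y <= r].

Definition covered_by (R : realType) (X : metricType R) (r : R) (n : nat)
  : Prop :=
  exists c : 'I_n -> X, [set: X] `<=` \bigcup_i mclosed_ball (c i) r.

(* By convention 0 when no finite number of balls covers X; this does not
   happen when X is compact and r > 0 (see [covering_numberP]). *)
Definition covering_number (R : realType) (X : metricType R) (r : R) : nat :=
  xget 0%N [set n | covered_by X r n
                    /\ forall m, covered_by X r m -> (n <= m)%N].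

Lemma covering_numberP (R : realType) (X : metricType R) (r : R) :
  compact [set: X] -> 0 < r ->
  covered_by X r (covering_number X r) /\
  forall m, covered_by X r m -> (covering_number X r <= m)%N.
Proof.
move=> cX r0; rewrite /covering_number.
suff [n cn] : exists n, covered_by X r n.
  have exP : exists n, `[< covered_by X r n >] by exists n; apply/asboolP.
  apply: (xgetPex 0%N (P := [set n | covered_by X r n
                    /\ forall m, covered_by X r m -> (n <= m)%N])).
  case: (ex_minnP exP) => k /asboolP ck kmin; exists k; split => // m cm.
  by apply: kmin; apply/asboolP.
have [[x0 _]|X0] := pselect ([set: X] !=set0); last first.
  have ord0F (i : 'I_0) : X by case: i.
  by exists 0%N, ord0F => x _; exfalso; apply: X0; exists x.
pose X' : ptopologicalType := HB.pack X (isPointed.Build X x0).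
have : cover_compact (T := X') [set: X'] by rewrite -compact_cover.
move=> /(_ X [set: X] (fun x : X => interior (ball x r))).
case=> [x _|x _|D _ DX]; first exact: open_interior.
  by exists x => //; exact: nbhsx_ballx.
set s := finmap.enum_fset D in DX.
exists (size s), (fun i => tnth (in_tuple s) i) => x _.
have [y yD xy] := DX x I.
have yi : (index y s < size s)%N by rewrite index_mem.
exists (Ordinal yi) => //; rewrite (tnth_nth y) /= nth_index //.
by move/interior_subset: xy; rewrite ballEmdist => /ltW.
Qed.

Definition lipschitz_within (R : realType) (X Y : metricType R) (A : set X)
    (f : X -> Y) : Prop :=
  exists L : R, forall x z, A x -> A z -> mdist (f x) (f z) <= L * mdist x z.

(* What remains of [a, b] after n rounds, each removing the open middle third
   of every remaining segment. *)
Fixpoint middle_third_stage (R : realType) (n : nat) (a b : R) : set R :=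
  if n is m.+1 then
    middle_third_stage m a (a + (b - a) / 3) `|`
    middle_third_stage m (b - (b - a) / 3) b
  else `[a, b].

Definition cantor_set (R : realType) : set R :=
  \bigcap_n middle_third_stage n 0 1.

(* A map is defined on all of the line, but only its restriction to the
   Cantor set matters: any map from the Cantor set to B extends, with
   arbitrary values elsewhere, since B is then nonempty. The regular module
   R^o is R, carrying the distance |x - y|. *)
Definition cantor_lipschitz_onto (R : realType) (B : metricType R) : Prop :=
  exists f : R^o -> B,
    lipschitz_within (@cantor_set R : set R^o) f /\ f @` @cantor_set R = [set: B].

(* Main.v *)
(* Points of the Cantor set are coded by their sequences of ternary digits
   (0 and 2, read as booleans): points closer than 3^-n share n digits, and
   points sharing n digits are at distance at most 3^-n.

   (2) If 3^k bounds the Lipschitz constant, the images of the 2^(n+k) pieces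
   with prescribed first n + k digits lie in balls of radius 3^-n, so
   b_n <= 2^(n+k).

   (1) Minimal 3^-n-nets, n >= 0, form a tree with b_n nodes at level n, each
   node being joined to one of the previous level at distance at most 3^-n.
   Give a node v of level n the integer weight
   N(v) = 1 + floor(1/2 sum of the weights of its children), in the limit over
   finite truncations of the tree; the weights of level n sum to at most
   sum_m b_(n+m)/2^m, which is finite. Since the children of v weigh at most
   2 N(v) together, one can assign to every v disjoint families of N(v) binary
   words of length k + n such that words of children extend words of their
   parents. Sending x to the node assigned to the first k + n digits of x, or to
   the last node met before if there is none, gives maps converging uniformly at
   rate 3^-n to a Lipschitz map with dense, hence full, range. *)
Require Import Defs.
From mathcomp Require Import all_boot all_order all_algebra.
From mathcomp Require Import all_classical all_reals all_analysis.
From mathcomp Require Import zify ring lra.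

Set Implicit Arguments.
Unset Strict Implicit.
Unset Printing Implicit Defensive.

Import Order.TTheory GRing.Theory Num.Theory.
Import numFieldNormedType.Exports.
Local Open Scope classical_set_scope.
Local Open Scope ring_scope.

(** * Digits of the Cantor set *)

(** Self-similarity of the stages: scale 3 blows a third up to the whole segment, scale 1/3 puts it
    back. *)
Lemma middle_third_stage_affine (R : realType) n (a b s t x : R) : 0 < s ->
  middle_third_stage n a b x ->
  middle_third_stage n (s * a + t) (s * b + t) (s * x + t).
Proof.
move=> s0; elim: n a b => [|n IH] a b /=.
  by rewrite /= !in_itv /= => /andP[ax xb]; rewrite !lerD2r !ler_pM2l// ax.
have -> : s * b + t - (s * a + t) = s * (b - a) by ring.
case=> /IH H; [left|right].
  by congr (middle_third_stage _ _ _ _): H; field.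
by congr (middle_third_stage _ _ _ _): H; field.
Qed.

Lemma middle_third_stage_itv (R : realType) n (a b : R) : a <= b ->
  middle_third_stage n a b `<=` `[a, b].
Proof.
elim: n a b => [|n IH] a b ab x //=; rewrite in_itv /=.
by case=> /IH; rewrite /= in_itv /= => H; apply/andP; split; lra.
Qed.

Lemma cantor_set_itv (R : realType) (x : R) : cantor_set x -> 0 <= x <= 1.
Proof. by move=> /(_ 0 I) /=; rewrite in_itv. Qed.

(** The expanding map deleting the first ternary digit. The threshold 1/2 lies in the removed middle
    third, so it separates the two halves of the Cantor set. *)
Definition cantor_shift (R : realType) (x : R) : R :=
  if 1/2 < x then 3 * x - 2 else 3 * x.

Definition cantor_digit (R : realType) (x : R) (i : nat) : bool :=
  1/2 < iter i (@cantor_shift R) x.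

Lemma cantor_set_shift (R : realType) (x : R) :
  cantor_set x -> cantor_set (cantor_shift x).
Proof.
move=> Cx n _; have /= := Cx n.+1 I.
rewrite subr0 add0r /cantor_shift => -[] H.
  have /= := @middle_third_stage_itv R n 0 (1 / 3) ltac:(lra) _ H.
  rewrite in_itv /= => x13.
  rewrite ifF; last lra.
  have := @middle_third_stage_affine R n _ _ 3 0 _ ltac:(lra) H.
  by rewrite !addr0 mulr0 mul1r divff.
have /= := @middle_third_stage_itv R n (1 - 1 / 3) 1 ltac:(lra) _ H.
rewrite in_itv /= => x23.
rewrite ifT; last lra.
have := @middle_third_stage_affine R n _ _ 3 (- 2) _ ltac:(lra) H.
by congr (middle_third_stage _ _ _ _); field.
Qed.

Lemma cantor_set_gap (R : realType) (x : R) : cantor_set x ->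
  if 1/2 < x then 2 / 3 <= x else x <= 1 / 3.
Proof.
move=> /cantor_set_shift/cantor_set_itv; rewrite /cantor_shift.
by case: ifP => _; lra.
Qed.

Lemma cantor_set_left (R : realType) (y : R) :
  cantor_set y -> cantor_set (y / 3).
Proof.
move=> Cy [|n] _ /=; first by have := cantor_set_itv Cy; rewrite in_itv /=; lra.
left; have := @middle_third_stage_affine R n _ _ (1 / 3) 0 _ ltac:(lra) (Cy n I).
by congr (middle_third_stage _ _ _ _); field.
Qed.

Lemma cantor_set_right (R : realType) (y : R) :
  cantor_set y -> cantor_set (y / 3 + 2 / 3).
Proof.
move=> Cy [|n] _ /=; first by have := cantor_set_itv Cy; rewrite in_itv /=; lra.
right; have :=
  @middle_third_stage_affine R n _ _ (1 / 3) (2 / 3) _ ltac:(lra) (Cy n I).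
by congr (middle_third_stage _ _ _ _); field.
Qed.

Lemma cantor_set0 (R : realType) : cantor_set (0 : R).
Proof.
move=> n _; suff : forall b : R, 0 <= b -> middle_third_stage n 0 b 0.
  by apply; lra.
elim: n => [|n IH] b b0 /=; first by rewrite in_itv /= lexx.
by left; apply: IH; lra.
Qed.

Lemma cantor_digit0 (R : realType) (x : R) : cantor_digit x 0 = (1/2 < x).
Proof. by []. Qed.

Lemma cantor_digitS (R : realType) (x : R) i :
  cantor_digit x i.+1 = cantor_digit (cantor_shift x) i.
Proof. by rewrite /cantor_digit iterSr. Qed.

(** Starting from 0, the inverse branches of the shift prepend the digits one at a time. *)
Lemma cantor_digit_surj (R : realType) n (w : nat -> bool) :
  exists2 x : R, cantor_set x & forall i, (i < n)%N -> cantor_digit x i = w i.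
Proof.
elim: n w => [|n IH] w; first by exists 0 => //; exact: cantor_set0.
have [y Cy yw] := IH (fun i => w i.+1).
have yI := cantor_set_itv Cy.
case w0 : (w 0); [exists (y / 3 + 2 / 3) | exists (y / 3)].
- exact: cantor_set_right.
- have E : 1 / 2 < y / 3 + 2 / 3 by lra.
  move=> [|i] lin; first by rewrite cantor_digit0 w0.
  by rewrite cantor_digitS -yw// /cantor_shift E; congr cantor_digit; field.
- exact: cantor_set_left.
- have E : (1 / 2 < y / 3) = false by lra.
  move=> [|i] lin; first by rewrite cantor_digit0 w0.
  by rewrite cantor_digitS -yw// /cantor_shift E; congr cantor_digit; field.
Qed.

Lemma cantor_shift_dist (R : realType) (x z : R) :
  cantor_digit x 0 = cantor_digit z 0 ->
  `|cantor_shift x - cantor_shift z| = 3 * `|x - z|.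
Proof.
rewrite !cantor_digit0 /cantor_shift => ->.
transitivity `|3 * (x - z)|; last by rewrite normrM ger0_norm.
by case: ifP => _; congr `|_|; ring.
Qed.

(** Points on opposite sides of the middle gap are at least 1/3 apart, so the first digits agree;
    the shift then triples the distance. The points 1/3 and 2/3 show why the inequality is
    strict. *)
Lemma cantor_digit_close (R : realType) n (x z : R) :
  cantor_set x -> cantor_set z -> `|x - z| < 3 ^- n ->
  forall i, (i < n)%N -> cantor_digit x i = cantor_digit z i.
Proof.
elim: n x z => [//|n IH] x z Cx Cz xz.
have p3 : 0 < (3 : R) ^+ n by rewrite exprn_gt0.
have p31 : 3 ^- n <= 1 :> R by rewrite invf_le1// exprn_ege1//; lra.
move: xz; rewrite exprS invfM => xz.
have x0 : cantor_digit x 0 = cantor_digit z 0.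
  rewrite !cantor_digit0.
  have := cantor_set_gap Cx; have := cantor_set_gap Cz.
  move: xz; rewrite ltr_norml => /andP[].
  by case: ifP; case: ifP => //; lra.
move=> [//|i] lin; rewrite !cantor_digitS; apply: IH => //.
- exact: cantor_set_shift.
- exact: cantor_set_shift.
- by rewrite cantor_shift_dist//; lra.
Qed.

Lemma cantor_digit_dist (R : realType) n (x z : R) :
  cantor_set x -> cantor_set z ->
  (forall i, (i < n)%N -> cantor_digit x i = cantor_digit z i) ->
  `|x - z| <= 3 ^- n.
Proof.
elim: n x z => [|n IH] x z Cx Cz xz.
  have := cantor_set_itv Cx; have := cantor_set_itv Cz.
  by rewrite expr0 invr1 ler_norml; lra.
have : `|cantor_shift x - cantor_shift z| <= 3 ^- n.
  apply: IH; [exact: cantor_set_shift..|] => i lin.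
  by rewrite -!cantor_digitS xz.
rewrite cantor_shift_dist; last exact: xz.
by rewrite exprS invfM; lra.
Qed.

Lemma cantor_set_compact (R : realType) : compact (@cantor_set R).
Proof.
apply: (@subclosed_compact _ _ `[0 : R, 1]); last 2 first.
- exact: segment_compact.
- by move=> x /cantor_set_itv; rewrite /= in_itv.
apply: closed_bigI => n _; move: (0 : R) (1 : R).
elim: n => [|n IH] a b /=; first exact: itv_closed.
by apply: closedU; exact: IH.
Qed.

(** * Words assigned to the nodes of a tree *)

(** Over each [u], the two fibres are enumerated and matched by position. *)
Lemma fiberwise_injection (S T U : finType) (f : S -> U) (g : T -> U) :
  (forall u, #|[pred s | f s == u]| <= #|[pred t | g t == u]|)%N ->
  exists2 h : S -> T, injective h & forall s, g (h s) = f s.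
Proof.
move=> fg.
(* [nth] needs a default in [T]; if [T] is empty, so are all fibres of [f], hence [S]. *)
case: (pickP (@predT T)) => [t0 _|T0]; last first.
  have S0 (s : S) : False.
    have := leq_trans (fg (f s)) (max_card _); rewrite [#|T|]eq_card0//.
    by rewrite leqn0 => /eqP/card0_eq/(_ s); rewrite !inE eqxx.
  by exists (fun s => match S0 s with end) => s; case: (S0 s).
pose F u := enum [pred s | f s == u]; pose G u := enum [pred t | g t == u].
have memF u s : (s \in F u) = (f s == u) by rewrite /F mem_enum.
have memG u t : (t \in G u) = (g t == u) by rewrite /G mem_enum.
pose h s := nth t0 (G (f s)) (index s (F (f s))).
have hlt s : (index s (F (f s)) < size (G (f s)))%N.
  apply: (@leq_trans (size (F (f s)))); first by rewrite index_mem memF.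
  by rewrite /F /G -!cardE; exact: fg.
have gh s : g (h s) = f s by have := mem_nth t0 (hlt s); rewrite memG => /eqP.
exists h => // s s' hss'.
have fss' : f s = f s' by rewrite -!gh hss'.
have hlt' : (index s' (F (f s)) < size (G (f s)))%N by rewrite fss'.
move/eqP: hss'; rewrite /h -fss' nth_uniq ?enum_uniq// => /eqP.
by apply: index_inj; rewrite // memF ?fss'.
Qed.

Lemma bounded_nat_seq_max (s : nat -> nat) (K : nat) :
  (forall i, s i <= K)%N -> exists i0, forall i, (s i <= s i0)%N.
Proof.
move=> sK.
have ex : exists k, `[< exists i, s i = k >].
  by exists (s 0); apply/asboolP; exists 0.
have ub k : `[< exists i, s i = k >] -> (k <= K)%N by move=> /asboolP[i <-].
case: (ex_maxnP ex ub) => k /asboolP[i0 <-] max.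
by exists i0 => i; apply: max; apply/asboolP; exists i.
Qed.

(* The weight of v when only the M levels starting with that of v are kept. *)
Fixpoint tree_demand (T : nat -> finType) (p : forall n, T n.+1 -> T n)
    (M n : nat) (v : T n) : nat :=
  if M is M'.+1 then (\sum_(c | p n c == v) tree_demand p M' c)./2.+1 else 0.

Lemma tree_demandS (T : nat -> finType) (p : forall n, T n.+1 -> T n) M n
    (v : T n) :
  (tree_demand p M v <= tree_demand p M.+1 v)%N.
Proof.
elim: M n v => [//|M IH] n v; rewrite /= ltnS half_leq//.
by apply: leq_sum => c _; exact: IH.
Qed.

(** A node weighs at most 1 plus half the weight of its children, and every child has one parent; so
    each further level enters with another factor 1/2. *)
Lemma sum_tree_demand_le (R : realType) (T : nat -> finType)
    (p : forall n, T n.+1 -> T n) M n :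
  (\sum_(v : T n) tree_demand p M v)%:R <=
  \sum_(m < M) (#|T (n + m)%N|%:R / 2 ^+ m) :> R.
Proof.
elim: M n => [|M IH] n; first by rewrite big1// big_ord0.
rewrite big_ord_recl /= addn0 expr0 divr1.
have -> : \sum_(i < M) #|T (n + bump 0 i)%N|%:R / 2 ^+ bump 0 i =
          (\sum_(m < M) (#|T (n.+1 + m)%N|%:R / 2 ^+ m)) / 2 :> R.
  rewrite mulr_suml; apply: eq_bigr => i _.
  by rewrite /bump/= addnS -addSn exprS invfM; ring.
apply: (@le_trans _ _
    (#|T n|%:R + (\sum_(c : T n.+1) tree_demand p M c)%:R / 2)); last first.
  by have := IH n.+1; lra.
have -> : (\sum_(c : T n.+1) tree_demand p M c =
           \sum_(v : T n) \sum_(c | p n c == v) tree_demand p M c)%N.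
  exact: (partition_big (p n) predT).
rewrite -sum1_card !natr_sum mulr_suml -big_split /=.
apply: ler_sum => v _.
set k := (\sum_(_ | _) _)%N.
have : (k./2 * 2 <= k)%N by lia.
by rewrite -(ler_nat R) natrM -[(k./2).+1%:R]natr1; lra.
Qed.

Lemma exists_tree_demand (T : nat -> finType) (p : forall n, T n.+1 -> T n)
    (K : nat -> nat) :
  (forall n M, \sum_(v : T n) tree_demand p M v <= K n)%N ->
  exists N : forall n, T n -> nat,
    [/\ forall n v, (0 < N n v)%N,
        forall n v, (\sum_(c | p n c == v) N n.+1 c <= 2 * N n v)%N &
        (\sum_v N 0 v <= K 0)%N].
Proof.
move=> NK.
have mono n (v : T n) : {homo (fun M => tree_demand p M v) : M M' / (M <= M')%N}.
  by apply: homo_leq => [M|M'' M M'|M]; [|exact: leq_trans|exact: tree_demandS].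
(* Weights grow with the truncation depth, so a depth that maximises the total of a level maximises
   the weight of each node in it. *)
have stab n : exists M0, forall M (v : T n),
    (tree_demand p M v <= tree_demand p M0 v)%N.
  have [M0 M0max] := bounded_nat_seq_max (NK n).
  exists M0 => M v; case: (leqP M M0) => [/mono//|/ltnW M0M].
  have := M0max M; rewrite (bigD1 v)//= [X in (_ <= X)%N](bigD1 v)//=.
  have : (\sum_(i | i != v) tree_demand p M0 i <=
          \sum_(i | i != v) tree_demand p M i)%N.
    by apply: leq_sum => i _; exact: mono.
  lia.
have [M0 M0P] := choice stab.
exists (fun n v => tree_demand p (M0 n) v); split=> [n v|n v|//].
  exact: leq_trans (M0P n 1%N v).
(* At depth [(M0 n.+1).+1] the weight of [v] is computed from the final weights of its children, and
   s <= 2 (floor(s/2) + 1). *)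
apply: leq_trans (leq_mul (leqnn 2) (M0P n (M0 n.+1).+1 v)) => /=.
lia.
Qed.

Lemma exists_word_labelling (T : nat -> finType) (p : forall n, T n.+1 -> T n)
    (N : forall n, T n -> nat) (k : nat) :
  (forall n v, 0 < N n v)%N ->
  (forall n v, \sum_(c | p n c == v) N n.+1 c <= 2 * N n v)%N ->
  (\sum_v N 0 v <= 2 ^ k)%N ->
  exists a : forall n, seq bool -> option (T n),
    (forall n v, exists2 s, size s = (k + n)%N & a n s = Some v) /\
    (forall n s v, a n.+1 s = Some v -> a n (take (k + n) s) = Some (p n v)).
Proof.
move=> N0 Nc Nroot.
(* Each node [v] owns [N n v] slots, and each slot is to receive one word. *)
pose E n : finType := {v : T n & 'I_(N n v)}.
have card_tag n (P : pred (T n)) :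
    #|[pred e : E n | P (tag e)]| = (\sum_(v | P v) N n v)%N.
  rewrite -sum1_card.
  transitivity (\sum_(v | P v) \sum_(j : 'I_(N n v) | true) 1)%N.
    by rewrite sig_big_dep; apply: eq_bigl => e; rewrite inE andbT.
  by apply: eq_bigr => v _; rewrite sum1_card card_ord.
have [|w0 w0_inj _] := @fiberwise_injection (E 0) (k.-tuple bool) unit
    (fun=> tt) (fun=> tt).
  case; rewrite (card_tag 0 (fun=> tt == tt)) [X in (_ <= X)%N]eq_cardT//.
  by rewrite -cardE card_tuple card_bool.
(* The slots of the children of [v] inject into pairs of a slot of [v] and a bit; the bit will be
   appended to the word of that slot. *)
have step n : exists2 h : E n.+1 -> E n * bool, injective h &
    forall e, tag (h e).1 = p n (tag e).
  apply: (@fiberwise_injection (E n.+1) (E n * bool)%type (T n)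
    (fun e => p n (tag e)) (fun eb => tag eb.1)) => v.
  rewrite (card_tag _ (fun c => p n c == v)) (leq_trans (Nc n v))//.
  rewrite -sum1_card.
  have <- : (\sum_(e : E n | tag e == v) \sum_(b : bool | true) 1 = 2 * N n v)%N.
    transitivity (\sum_(e : E n | tag e == v) 2)%N.
      by apply: eq_bigr => e _; rewrite sum1_card card_bool.
    by rewrite sum_nat_const (card_tag _ (pred1 v)) big_pred1_eq mulnC.
  rewrite pair_big_dep; apply: eq_leq; apply: eq_bigl => e.
  by rewrite inE andbT.
pose h n := s2val (cid2 (step n)).
have h_inj n : injective (h n) by exact: s2valP (cid2 (step n)).
have h_tag n e : tag (h n e).1 = p n (tag e) by exact: s2valP' (cid2 (step n)) e.
pose w := fix w n : E n -> seq bool :=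
  if n is m.+1 then fun e => rcons (w m (h m e).1) (h m e).2 else w0.
have w_size n (e : E n) : size (w n e) = (k + n)%N.
  elim: n e => [|n IH] e; first by rewrite /= size_tuple addn0.
  by rewrite /= size_rcons IH addnS.
have w_inj n : injective (w n).
  elim: n => [|n IH] e e'; first by move=> /= /val_inj/w0_inj.
  move=> /= /rcons_inj[/IH h1 h2]; apply: h_inj.
  by rewrite [h n e]surjective_pairing h1 h2 -surjective_pairing.
pose a n (s : seq bool) := omap tag [pick e : E n | w n e == s].
have a_w n (e : E n) : a n (w n e) = Some (tag e).
  rewrite /a; case: pickP => [e' /eqP/w_inj ->//|/(_ e)].
  by rewrite eqxx.
exists a; split=> [n v|n s v].
  pose e : E n := Tagged (fun v => 'I_(N n v)) (Ordinal (N0 n v)).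
  by exists (w n e); rewrite ?a_w.
rewrite {1}/a; case: pickP => // e /eqP <- [<-].
by rewrite /= -cats1 take_size_cat ?w_size// a_w h_tag.
Qed.

(** * Limits of approximations *)

(* [metric_sym] and [metric_triangle] mention [mdist] through the realFieldType
   structure of R, which [lra] does not identify with its realType one. *)
Lemma mdistC (R : realType) (T : metricType R) (x y : T) : mdist x y = mdist y x.
Proof. exact: metric_sym. Qed.

Lemma mdist_le_add (R : realType) (T : metricType R) (x y z : T) :
  mdist x z <= mdist x y + mdist y z.
Proof. exact: metric_triangle. Qed.

Lemma le_exp3 (R : realType) (x : R) : exists n, x <= 3 ^+ n.
Proof.
exists (Num.truncn x).+1; apply: (le_trans (ltW (truncnS_gt x))).
by rewrite -natrX ler_nat ltnW// ltn_expl.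
Qed.

Lemma compact_seq_cluster (R : realType) (T : metricType R) (A : set T)
    (u : nat -> T) : compact A -> (forall n, A (u n)) ->
  exists2 x, A x & forall (e : R) n, 0 < e ->
    exists2 m, (n <= m)%N & mdist x (u m) < e.
Proof.
move=> cA uA.
have [|x [Ax xu]] := cA (u @ \oo) _; first by exists 0%N => // n _; exact: uA.
exists x => // e n e0.
have [|_ [[m nm <-]]] :=
    xu [set u m | m in [set m | (n <= m)%N]] (ball x e) _ (nbhsx_ballx _ _ e0).
  by exists n => // m nm; exists m.
by rewrite ballEmdist; exists m.
Qed.

Lemma compact_mdist_bounded (R : realType) (T : metricType R) :
  compact [set: T] -> exists D : R, forall x y : T, mdist x y <= D.
Proof.
move=> cT; have [+ _] := covering_numberP cT (@ltr01 R).
move: (covering_number _ _) => n [c cP].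
(* 2 accounts for the two unit radii; the double sum dominates every distance between centres. *)
exists (2 + \sum_i \sum_j mdist (c i) (c j)) => x y.
have [i _] := cP x I; have [j _] := cP y I; rewrite /mclosed_ball/= => jy ix.
have : mdist (c i) (c j) <= \sum_i \sum_j mdist (c i) (c j).
  rewrite (bigD1 i)//= (bigD1 j)//= -addrA lerDl addr_ge0//.
    by apply: sumr_ge0 => *; exact: mdist_ge0.
  by apply: sumr_ge0 => *; apply: sumr_ge0 => *; exact: mdist_ge0.
have := mdist_le_add x (c i) y; have := mdist_le_add (c i) (c j) y.
by rewrite (mdistC x (c i)); lra.
Qed.

Lemma cantor_lipschitz_onto_of_approx (R : realType) (B : metricType R) (k : nat)
    (g : nat -> R -> B) : compact [set: B] ->
  (forall n x, cantor_set x -> mdist (g n x) (g n.+1 x) <= 3 ^- n) ->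
  (forall n x z, cantor_set x -> cantor_set z -> `|x - z| < 3 ^- (k + n) ->
     g n x = g n z) ->
  (forall n y, exists2 x, cantor_set x & mdist (g n x) y <= 3 ^- n) ->
  cantor_lipschitz_onto B.
Proof.
move=> cB g_step g_const g_dense.
have V3_gt0 n : 0 < 3 ^- n :> R by rewrite invr_gt0 exprn_gt0.
have V3S n : 3 ^- n = 3 * 3 ^- n.+1 :> R by rewrite exprS invfM; lra.
have small (e : R) : 0 < e -> exists n, 3 ^- n <= e.
  move=> e0; have [n en] := le_exp3 e^-1; exists n.
  by rewrite invf_ple// posrE// exprn_gt0.
have g_tail n m x : cantor_set x -> mdist (g n x) (g (n + m)%N x) <= 2 * 3 ^- n.
  move=> Cx.
  (* The subtracted term leaves room for the next step in the induction on [m]. *)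
  suff : mdist (g n x) (g (n + m)%N x) <= 2 * 3 ^- n - 2 * 3 ^- (n + m).
    by have := V3_gt0 (n + m)%N; lra.
  elim: m => [|m IH]; first by rewrite addn0 mdistxx; have := V3_gt0 n; lra.
  rewrite addnS; have := mdist_le_add (g n x) (g (n + m)%N x) (g (n + m).+1 x).
  have := g_step (n + m)%N x Cx; have := V3_gt0 (n + m).+1.
  by have := V3S (n + m)%N; lra.
have lim x : exists y, cantor_set x -> forall n, mdist (g n x) y <= 2 * 3 ^- n.
  have [y _ yP] := compact_seq_cluster cB (fun n => I : [set: B] (g n x)).
  exists y => Cx n; apply/ler_addgt0Pr => e e0.
  have [m nm] := yP e n e0; have := g_tail n (m - n)%N x Cx; rewrite subnKC//.
  by have := mdist_le_add (g n x) (g m x) y; rewrite (mdistC y); lra.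
have [f fP] := choice lim.
have [D BD] := compact_mdist_bounded cB.
have f_lip : lipschitz_within (@cantor_set R : set R^o) (f : R^o -> B).
  (* [D] serves pairs at distance at least 3^-k. For the others 4 = 2 + 2 counts the errors of [g n]
     at both points, where n is the last scale at which they are close enough to share a value;
     3^(k+1) turns 3^-n into their distance. *)
  exists ((D + 4) * 3 ^+ k.+1) => x z Cx Cz.
  rewrite [mdist x z]distrC.
  have D0 : 0 <= D by exact: le_trans (mdist_ge0 _ _) (BD (f x) (f x)).
  have [->|xz] := eqVneq x z; first by rewrite mdistxx subrr normr0 mulr0.
  have d0 : 0 < `|x - z| by rewrite normr_gt0 subr_eq0.
  have : exists n, 3 ^- (k + n) <= `|x - z|.
    have [n nP] := small _ d0; exists n; apply: le_trans nP.
    by rewrite lef_pV2 ?posrE ?exprn_gt0// ler_weXn2l// ?leq_addl//; lra.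
  move=> /ex_minnP[[|n] nP nmin].
    apply: le_trans (BD _ _) _; apply: le_trans (_ : (D + 4) * 1 <= _); first lra.
    rewrite -mulrA ler_wpM2l//; first lra.
    have k3 : 1 <= 3 ^+ k * `|x - z|.
      by rewrite mulrC -ler_pdivrMr ?exprn_gt0// mul1r -[k]addn0.
    by rewrite exprS -mulrA; lra.
  have xz_lt : `|x - z| < 3 ^- (k + n).
    by rewrite ltNge; apply/negP => /nmin; rewrite ltnn.
  have := mdist_le_add (f x) (g n x) (f z).
  have := fP x Cx n; have := fP z Cz n.
  rewrite (mdistC (f x) (g n x)) -(g_const n x z)// => zn xn fxz.
  have : 3 ^- n <= 3 ^+ k.+1 * `|x - z|.
    rewrite mulrC -ler_pdivrMr ?exprn_gt0//.
    by rewrite -invfM -exprD addnC addSnnS.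
  have : 0 <= D * (3 ^+ k.+1 * `|x - z|) by rewrite !mulr_ge0// exprn_ge0.
  by rewrite -mulrA mulrDl; lra.
exists (f : R^o -> B); split => //; apply/seteqP; split => // y _.
(* A cluster point of near-preimages [u n] of [y] will be a preimage of [y]. *)
have [u uP] : exists u : nat -> R, forall n,
    cantor_set (u n) /\ mdist (g n (u n)) y <= 3 ^- n.
  have H n : exists x, cantor_set x /\ mdist (g n x) y <= 3 ^- n.
    by have [x ? ?] := g_dense n y; exists x.
  by have [u] := choice H; exists u.
have [x Cx xP] := @compact_seq_cluster R R^o (@cantor_set R) u
  (@cantor_set_compact R) (fun n => (uP n).1).
exists x => //; apply/mdist_positivity/eqP; rewrite eq_le mdist_ge0 andbT.
have [L fL] := f_lip.
apply/ler_addgt0Pr => e e0; rewrite add0r.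
have L0 : 0 < `|L| + 1 by rewrite ltr_pwDr.
(* Half of [e] pays for moving from [x] to [u m]; the other half for 2 * 3^-m from [f] to [g m],
   plus 3^-m from [g m] to [y]. *)
have [n nP] := small (e / 6) ltac:(lra).
have [m nm xm] := xP (e / 2 / (`|L| + 1)) n ltac:(by rewrite !divr_gt0).
have [Cu uy] := uP m.
have := fL x (u m) Cx Cu; have := fP _ Cu m.
have := mdist_le_add (f x) (f (u m)) y.
have := mdist_le_add (f (u m)) (g m (u m)) y.
rewrite (mdistC (f (u m)) (g m (u m))).
have : L * mdist (x : R^o) (u m) <= e / 2.
  apply: le_trans (_ : (`|L| + 1) * mdist (x : R^o) (u m) <= _).
    by rewrite ler_wpM2r ?mdist_ge0//; have := ler_norm L; lra.
  by rewrite mulrC -ler_pdivlMr// ltW.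
have : 3 ^- m <= 3 ^- n :> R.
  by rewrite lef_pV2 ?posrE ?exprn_gt0// ler_weXn2l//; lra.
lra.
Qed.

(** * Covering numbers and Lipschitz images *)

Lemma eq_in_mkseq (T : Type) (f g : nat -> T) n :
  (forall i, (i < n)%N -> f i = g i) -> mkseq f n = mkseq g n.
Proof.
move=> fg; case: n fg => [//|n] fg; apply: (@eq_from_nth _ (f 0)).
  by rewrite !size_mkseq.
by move=> i; rewrite size_mkseq => lin; rewrite !nth_mkseq// fg.
Qed.

Lemma cantor_lipschitz_onto_of_cvg (R : realType) (B : metricType R) :
  [set: B] !=set0 -> compact [set: B] ->
  let b n := covering_number B ((3 : R) ^- n) in
  cvgn (fun N : nat => \sum_(1 <= n < N) ((b n)%:R / 2 ^+ n : R)) ->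
  cantor_lipschitz_onto B.
Proof.
move=> [y0 _] cB b cvg_b.
have V3_gt0 n : 0 < 3 ^- n :> R by rewrite invr_gt0 exprn_gt0.
pose T n : finType := 'I_(b n).
have cov n : exists c : T n -> B, forall y, exists v, mdist (c v) y <= 3 ^- n.
  have [[c cP] _] := covering_numberP cB (V3_gt0 n).
  by exists c => y; have [v _] := cP y I; exists v.
pose c n := sval (cid (cov n)).
have cP n y : exists v, mdist (c n v) y <= 3 ^- n := svalP (cid (cov n)) y.
pose p n (v : T n.+1) : T n := sval (cid (cP n (c n.+1 v))).
have pP n v : mdist (c n (p n v)) (c n.+1 v) <= 3 ^- n :=
  svalP (cid (cP n (c n.+1 v))).
(* The tree starts at level 0 and the series at 1, so the term of index 0 is added to the limit. *)
have [S SP] : exists S : R, forall N, \sum_(0 <= n < N) ((b n)%:R / 2 ^+ n) <= S.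
  have b_ge0 n : 0 <= (b n)%:R / 2 ^+ n :> R by rewrite divr_ge0// exprn_ge0.
  exists ((b 0)%:R / 2 ^+ 0 +
    limn (fun N : nat => \sum_(1 <= n < N) ((b n)%:R / 2 ^+ n : R))) => -[|N].
    rewrite big_geq// addr_ge0//.
    apply: limr_ge => //; near=> n; exact: sumr_ge0.
  rewrite big_ltn// lerD2l.
  apply: (nondecreasing_cvgn_le _ cvg_b) => m n mn.
  case: m mn => [|m] mn; first by rewrite big_geq// sumr_ge0.
  by rewrite [leRHS](@big_cat_nat _ _ _ m.+1)//= lerDl sumr_ge0.
have demand_le n M :
    (\sum_(v : T n) tree_demand p M v <= Num.truncn (2 ^+ n * S))%N.
  have S_ge0 : 0 <= S by have := SP 0; rewrite big_geq.
  rewrite truncn_ge_nat ?mulr_ge0 ?exprn_ge0//.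
  apply: (le_trans (@sum_tree_demand_le R T p M n)).
  (* The bound obtained from the tree is 2^n times the block of the series from n to n + M. *)
  apply: le_trans (ler_wpM2l (exprn_ge0 n _) (SP (n + M)%N)) => //.
  rewrite (@big_cat_nat _ _ _ n)//= ?leq_addr// mulrDr.
  rewrite -[leLHS]add0r lerD//.
    rewrite mulr_ge0 ?exprn_ge0//; apply: sumr_ge0 => i _.
    by rewrite divr_ge0 ?exprn_ge0.
  have -> : \sum_(n <= i < n + M) (b i)%:R / 2 ^+ i =
            \sum_(m < M) (b (n + m)%N)%:R / 2 ^+ (n + m) :> R.
    rewrite -{1}[n]add0n big_addn addKn big_mkord.
    by apply: eq_bigr => m _; rewrite addnC.
  rewrite mulr_sumr; apply: ler_sum => m _.
  by rewrite card_ord exprD invfM mulrCA mulVKf ?expf_neq0.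
have [N [N_gt0 N_children N_root]] := exists_tree_demand demand_le.
(* The weights of level 0 total at most k < 2^k, so words of length k suffice for them. *)
pose k := Num.truncn (2 ^+ 0 * S).
have [|a [a_surj a_take]] := exists_word_labelling (k := k) N_gt0 N_children.
  by apply: leq_trans N_root (ltnW (ltn_expl _ _)).
(* [y0] is the value when none of the prefixes of lengths k to k + n carries a node. *)
pose g := fix g n (x : R) : B :=
  if a n (mkseq (cantor_digit x) (k + n)) is Some v then c n v
  else if n is m.+1 then g m x else y0.
have gE n x v : a n (mkseq (cantor_digit x) (k + n)) = Some v -> g n x = c n v.
  by case: n v => [|n] v /= ->.
apply: (@cantor_lipschitz_onto_of_approx R B k g) => //.
- move=> n x _; rewrite [g n.+1 x]/=.
  case av : (a n.+1 _) => [v|]; last by rewrite mdistxx ltW.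
  (* A prefix that carries a node extends one carrying its parent, so a fallback value is never
     followed by a jump to a node. *)
  suff /gE -> : a n (mkseq (cantor_digit x) (k + n)) = Some (p n v) by exact: pP.
  rewrite -(a_take _ _ _ av) /mkseq -map_take take_iota.
  by rewrite addnS (minn_idPl (leqnSn _)).
- move=> n x z Cx Cz; elim: n => [|n IH] xz /=.
    by rewrite (eq_in_mkseq (cantor_digit_close Cx Cz xz)).
  rewrite (eq_in_mkseq (cantor_digit_close Cx Cz xz)) IH//.
  apply: lt_le_trans xz _.
  by rewrite lef_pV2 ?posrE ?exprn_gt0// ler_weXn2l// ?addnS//; lra.
- move=> n y; have [v vy] := cP n y; have [s s_size s_v] := a_surj n v.
  have [x Cx xs] := cantor_digit_surj R (k + n) (nth false s).
  exists x => //; rewrite (gE n x v)//.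
  by rewrite (eq_in_mkseq xs) -s_size mkseq_nth.
Unshelve. all: by end_near. Qed.

Lemma covering_number_le_of_lipschitz (R : realType) (B : metricType R) :
  compact [set: B] -> cantor_lipschitz_onto B ->
  exists k, forall n, (covering_number B ((3 : R) ^- n) <= 2 ^ (n + k))%N.
Proof.
move=> cB [f [[L fL] f_onto]].
have [k Lk] := le_exp3 L; exists k => n.
have V3_gt0 : 0 < 3 ^- n :> R by rewrite invr_gt0 exprn_gt0.
have [_] := covering_numberP cB V3_gt0; apply.
have xP (w : (n + k).-tuple bool) : exists x : R, cantor_set x /\
    forall i, (i < n + k)%N -> cantor_digit x i = nth false w i.
  by have [x ? ?] := cantor_digit_surj R (n + k) (nth false w); exists x.
have [x {}xP] := choice xP.
have card_w : #|{: (n + k).-tuple bool}| = (2 ^ (n + k))%N.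
  by rewrite card_tuple card_bool.
(* The centres are the images of one Cantor point per word of length n + k; L 3^-(n+k) <= 3^-n by
   the choice of [k]. *)
exists (fun i => f (x (enum_val (cast_ord (esym card_w) i)))) => y _.
have [z Cz <-] : [set f z | z in @cantor_set R] y by rewrite f_onto.
pose w : (n + k).-tuple bool := [tuple cantor_digit z i | i < n + k].
exists (cast_ord card_w (enum_rank w)) => //=.
rewrite /mclosed_ball /= cast_ordK enum_rankK.
have [Cx xw] := xP w.
apply: (le_trans (fL _ _ Cx Cz)).
have xz : `|z - x w| <= 3 ^- (n + k).
  apply: cantor_digit_dist => // i i_lt; rewrite xw//.
  by rewrite -[i]/(nat_of_ord (Ordinal i_lt)) -tnth_nth tnth_mktuple.
apply: (@le_trans _ _ (3 ^+ k * 3 ^- (n + k))).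
  apply: le_trans (ler_wpM2r (normr_ge0 _) Lk) _.
  by rewrite ler_wpM2l// exprn_ge0.
by rewrite exprD invfM mulrCA divff ?mulr1// expf_neq0.
Qed.

Theorem corollary4p5 (R : realType) (B : metricType R)
    (B_nonempty : [set: B] !=set0) (B_compact : compact [set: B]) :
  let b (n : nat) : nat := covering_number B ((3 : R) ^- n) in
  (cvgn (fun N : nat => \sum_(1 <= n < N) ((b n)%:R / 2 ^+ n : R)) ->
     cantor_lipschitz_onto B)
  /\
  (cantor_lipschitz_onto B ->
     bounded_fun (fun n : nat => (b n)%:R / 2 ^+ n : R^o)).
Proof.
move=> b; split; first exact: cantor_lipschitz_onto_of_cvg.
move=> /(covering_number_le_of_lipschitz B_compact)[k bk].
exists (2 ^+ k); split; first by rewrite num_real.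
move=> M kM n _ /=; apply: le_trans (ltW kM).
rewrite ger0_norm ?divr_ge0 ?exprn_ge0// ler_pdivrMr ?exprn_gt0//.
by rewrite -exprD addnC -natrX ler_nat; exact: (bk n).
Qed.
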